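(* (One-dimensional $L^1$ regularity.) Let $\Sigma$ be a Boolean algebra with a fixed additive $\mu:\Sigma\to[0,1]$, $\mu(\Omega)=1$. Let $\nu:\Sigma\to\mathbb R$ be additive and absolutely continuous, let $\mathcal A$ be a partition, let $E,D$ be positive integers, and let $\mathbf B$ be a function on partitions. Then there exists a partition $\mathcal B_\sharp\succeq\mathcal A$ such that for every $\mathcal B\in[\mathcal B_\sharp,\mathbf B(\mathcal B_\sharp)]$, $$\mu\bigl(\mathfrak D_{E,\mathcal B_\sharp,\nu}(\mathcal B)\bigr)<\frac1D.$$
   Context: $\Sigma$ has largest element $\Omega$, least element $\emptyset$, operations $\cup,\cap$; $\sigma\subseteq\tau$ means $\sigma\cup\tau=\tau$. $\nu:\Sigma\to\mathbb R$ is additive if $\nu(\emptyset)=0$ and $\nu(\sigma\cup\tau)=\nu(\sigma)+\nu(\tau)-\nu(\sigma\cap\tau)$. A partition is a finite set $\mathcal A\subseteq\Sigma$ of pairwise disjoint elements (its union need not be $\Omega$). For $F:\Sigma\to\mathbb R$ put $F(\mathcal A)=\sum_{\sigma\in\mathcal A}F(\sigma)$; $|\nu|(\sigma)=|\nu(\sigma)|$, so $|\nu|(\mathcal A)=\sum_{\sigma\in\mathcal A}|\nu(\sigma)|$. $\mathcal A\preceq\mathcal B$ ($\mathcal B$ refines $\mathcal A$) if $\bigcup\mathcal A=\bigcup\mathcal B$ and every $\sigma\in\mathcal B$ is contained in some element of $\mathcal A$, denoted $\sigma_{\mathcal A}$. $[\mathcal A,\mathcal B]$ is the set of partitions $\mathcal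 C$ with $\mathcal A\preceq\mathcal C\preceq\mathcal B$. A function on partitions is a map $\mathbf B$ from partitions to partitions with $\mathcal A\preceq\mathbf B(\mathcal A)$ for all $\mathcal A$. $\nu$ is absolutely continuous if for every positive integer $E$ there is a positive integer $D$ such that $|\nu|(\mathcal A)<1/E$ for every partition $\mathcal A$ with $\mu(\mathcal A)<1/D$. $\delta_\nu(\sigma)=\nu(\sigma)/\mu(\sigma)$ (the convention when $\mu(\sigma)=0$ is immaterial here). For $\mathcal B_0\preceq\mathcal B$, $\mathfrak D_{E,\mathcal B_0,\nu}(\mathcal B)=\{\sigma\in\mathcal B: |\delta_\nu(\sigma)-\delta_\nu(\sigma_{\mathcal B_0})|\ge 1/E\}$. *)

(* Defs.v *)
From HB Require Import structures.
From mathcomp Require Import all_boot all_order all_algebra.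
From mathcomp Require Import finmap.
From mathcomp Require Import reals.
Set Implicit Arguments.
Unset Strict Implicit.
Unset Printing Implicit Defensive.
Import Order.TTheory GRing.Theory Num.Theory.
Local Open Scope fset_scope.
Local Open Scope ring_scope.

Section Regularity.
Context {d : Order.disp_t} {S : ctbDistrLatticeType d} {R : realType}.
Implicit Types (nu mu F : S -> R) (A : {fset S}).

Definition additive_fun nu : Prop :=
  nu \bot%O = 0 /\
  forall s t : S, nu (s `|` t)%O = nu s + nu t - nu (s `&` t)%O.

(* The bottom element is allowed to belong to a partition, and the join of a
   partition is not required to be the top element. *)
Definition is_partition A : bool :=
  [forall s : A, forall t : A,
    (s != t) ==> ((val s `&` val t)%O == \bot%O)].

Record fpartition : Type := FPartition {
  pset :> {fset S};
  psetP : is_partition pset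
}.

Definition fset_sum F A : R := \sum_(s <- A) F s.

Definition absval nu : S -> R := fun s => `|nu s|.

Definition refined_by (P Q : fpartition) : Prop :=
  (\join_(s <- P) s)%O = (\join_(s <- Q) s)%O /\
  forall s, s \in pset Q -> exists2 t, t \in pset P & (s <= t)%O.

Definition absolutely_continuous mu nu : Prop :=
  forall E : nat, (0 < E)%N ->
  exists2 D : nat, (0 < D)%N &
    forall P : fpartition,
      fset_sum mu P < D%:R^-1 -> fset_sum (absval nu) P < E%:R^-1.

(* When mu s = 0 this is 0, since 0^-1 = 0. *)
Definition density mu nu (s : S) : R := nu s / mu s.

(* An element of A above s. It is the only one if A is a partition and s is
   not \bot; the default value \bot is used only if there is none. *)
Definition ancestor A (s : S) : S :=
  odflt \bot%O (omap val [pick t : A | (s <= val t)%O]).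

Definition deviation_set mu nu (E : nat) (P0 P : fpartition) : {fset S} :=
  [fset s in pset P |
    E%:R^-1 <= `|density mu nu s - density mu nu (ancestor P0 s)|].

End Regularity.

Arguments fpartition {d} S.

(* Main.v *)
(* Refining a partition P increases the energy
   sum_(s in P) sqrt (mu s ^ 2 + nu s ^ 2), by the triangle inequality in the
   plane. Absolute continuity makes nu bounded, hence of bounded variation, so
   that the energy is bounded; hence there is a refinement Bs of A that no
   further refinement improves by more than a prescribed amount. Since
   x |-> sqrt (1 + x ^ 2) is uniformly convex on bounded intervals, cells whose
   density differs much from that of their parent contribute a definite energy
   gain, unless the density of the parent is large; by the bound on the
   variation, such parents have small total measure. The energy
   sum_(s in P) nu s ^ 2 / mu s would not do, since it can be unbounded. *)
Require Import Defs.
From HB Require Import structures.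
From mathcomp Require Import all_boot all_order all_algebra.
From mathcomp Require Import finmap.
From mathcomp Require Import boolp classical_sets reals.
From mathcomp Require Import ring lra.
Set Implicit Arguments.
Unset Strict Implicit.
Unset Printing Implicit Defensive.
Import Order.TTheory Order.CTheory GRing.Theory Num.Theory.
Local Open Scope ring_scope.

(** * The Euclidean norm of the plane and its convexity *)

Section Hypotenuse.
Context {R : realType}.
Implicit Types (a b m n x y e K : R).

Definition hyp a b : R := Num.sqrt (a ^+ 2 + b ^+ 2).

Lemma hyp_ge0 a b : 0 <= hyp a b.
Proof. exact: sqrtr_ge0. Qed.

Lemma sqr_hyp a b : hyp a b ^+ 2 = a ^+ 2 + b ^+ 2.
Proof. by rewrite sqr_sqrtr// addr_ge0 ?sqr_ge0. Qed.

Lemma hyp_le_norm a b : hyp a b <= `|a| + `|b|.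
Proof.
rewrite -(ler_pXn2r (n := 2)) ?nnegrE ?hyp_ge0 ?addr_ge0//.
rewrite sqr_hyp sqrrD !real_normK ?num_real//.
have := mulr_ge0 (normr_ge0 a) (normr_ge0 b); lra.
Qed.

Lemma hyp_cauchy a b m n : `|a * m + b * n| <= hyp a b * hyp m n.
Proof.
rewrite -(ler_pXn2r (n := 2)) ?nnegrE ?mulr_ge0 ?hyp_ge0//.
rewrite real_normK ?num_real// exprMn !sqr_hyp -subr_ge0.
suff -> : (a ^+ 2 + b ^+ 2) * (m ^+ 2 + n ^+ 2) - (a * m + b * n) ^+ 2
  = (a * n - b * m) ^+ 2 by exact: sqr_ge0.
ring.
Qed.

Lemma hyp_scale m x : 0 <= m -> hyp m (m * x) = m * hyp 1 x.
Proof.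
move=> m0; rewrite /hyp.
have -> : m ^+ 2 + (m * x) ^+ 2 = m ^+ 2 * (1 ^+ 2 + x ^+ 2) by ring.
by rewrite sqrtrM ?sqr_ge0// sqrtr_sqr ger0_norm.
Qed.

(* The quotient is the linear functional supporting the norm hyp at (m, n),
   evaluated at (a, b); it is 0 when m = n = 0. *)
Lemma hyp_supporting a b m n : (a * m + b * n) / hyp m n <= hyp a b.
Proof.
have [->|h0] := eqVneq (hyp m n) 0; first by rewrite invr0 mulr0 hyp_ge0.
rewrite ler_pdivrMr ?lt_def ?h0 ?hyp_ge0//.
exact: le_trans (ler_norm _) (hyp_cauchy _ _ _ _).
Qed.

(** A lower bound for the height of the graph of [hyp 1] over its tangent at [y], for [y] in
    [[-K, K]], at distance [e] from [y]: [1 + K + e] bounds [hyp 1] there, and [1 + K ^+ 2] bounds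
    [hyp 1 y ^+ 2]. *)
Definition convexity_gap K e : R :=
  e ^+ 2 / (2 * (1 + K + e) * (1 + K ^+ 2)).

Lemma convexity_gap_gt0 K e : 0 <= K -> 0 < e -> 0 < convexity_gap K e.
Proof.
move=> K0 e0; rewrite divr_gt0 ?exprn_gt0// !mulr_gt0//.
  by rewrite ltr_wpDl// addr_ge0.
by rewrite ltr_wpDr// sqr_ge0.
Qed.

(** The quotient is the tangent to [hyp 1] at [y], taken at [x], so the gap is the Cauchy-Schwarz
    defect of [(1, x)] and [(1, y)], divided by [hyp 1 y]. *)
Lemma slope_gap K e x y : 0 < e -> `|y| <= K -> e <= `|x - y| ->
  convexity_gap K e <= hyp 1 x - (1 + x * y) / hyp 1 y.
Proof.
move=> e0 yK exy.
have K0 : 0 <= K by exact: le_trans yK.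
have hge1 z : 1 <= hyp 1 z.
  rewrite -(ler_pXn2r (n := 2)) ?nnegrE ?hyp_ge0// sqr_hyp.
  by rewrite expr1n lerDl sqr_ge0.
have := hyp_cauchy 1 x 1 y; have := hyp_le_norm 1 x.
have := sqr_hyp 1 x; have := sqr_hyp 1 y; have := hge1 x; have := hge1 y.
rewrite normr1 !mul1r expr1n.
set p := hyp 1 x; set q := hyp 1 y; set w := 1 + x * y; set u := `|x - y|.
move=> q1 p1 q2 p2 pu wpq.
have p0 : 0 < p by lra.
have q0 : 0 < q by lra.
have u2 : u ^+ 2 = (x - y) ^+ 2 by rewrite real_normK ?num_real.
have uK : p <= 1 + K + u.
  have : `|x| <= u + `|y| by rewrite -{1}(subrK y x) ler_normD.
  lra.
have qK : q ^+ 2 <= 1 + K ^+ 2.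
  by rewrite q2 lerD2l -(real_normK (num_real y)) lerXn2r ?nnegrE.
(* The defect in Cauchy-Schwarz: (1 + x^2)(1 + y^2) - (1 + xy)^2 = (x - y)^2. *)
have defect : u ^+ 2 <= 2 * p * q * (p * q - w).
  have -> : u ^+ 2 = (p * q + w) * (p * q - w).
    by rewrite u2 mulrC -subr_sqr exprMn p2 q2 /w; ring.
  have [_ wpq'] := ler_normlP _ _ wpq.
  apply: ler_wpM2r; [lra | lra].
have den0 : 0 < (1 + K + e) by lra.
have K21 : 0 < 1 + K ^+ 2 by have := sqr_ge0 K; lra.
(* As [u ^+ 2 / (1 + K + u)] increases with [u >= 0], its value at [e] is a lower bound. *)
have ineq : e ^+ 2 * (p * q ^+ 2) <= u ^+ 2 * ((1 + K + e) * (1 + K ^+ 2)).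
  have e_p : e ^+ 2 * p <= u ^+ 2 * (1 + K + e).
    apply: (@le_trans _ _ (e ^+ 2 * (1 + K + u))).
      by rewrite ler_wpM2l ?sqr_ge0.
    have e2u2 : e ^+ 2 <= u ^+ 2 by rewrite lerXn2r ?nnegrE ?(ltW e0)// /u.
    have : e ^+ 2 * (1 + K) <= u ^+ 2 * (1 + K) by rewrite ler_wpM2r//; lra.
    have : (e * u) * e <= (e * u) * u.
      by apply: ler_wpM2l exy; apply: mulr_ge0; [exact: ltW | exact: normr_ge0].
    nra.
  rewrite [leLHS]mulrA [leRHS]mulrA; apply: (ler_pM _ _ e_p qK);
    last exact: sqr_ge0.
  by apply: mulr_ge0 (sqr_ge0 e) (ltW p0).
have -> : p - w / q = (p * q - w) / q by field; lra.
rewrite /convexity_gap ler_pdivrMr; last by rewrite !mulr_gt0.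
rewrite mulrAC ler_pdivlMr//.
rewrite -(ler_pM2r (mulr_gt0 p0 q0)).
have -> : e ^+ 2 * q * (p * q) = e ^+ 2 * (p * q ^+ 2) by ring.
apply: le_trans ineq _.
have := ler_wpM2r (ltW (mulr_gt0 den0 K21)) defect.
move/le_trans; apply; rewrite le_eqVlt; apply/orP; left; apply/eqP; ring.
Qed.

(** By homogeneity of [hyp], this is [slope_gap] for the slopes [b / a] and [n / m], multiplied by
    [a]. *)
Lemma hyp_gap K e a b m n : 0 <= K -> 0 < e -> 0 <= a <= m ->
  `|n| <= K * m -> e <= `|b / a - n / m| ->
  convexity_gap K e * a <= hyp a b - (a * m + b * n) / hyp m n.
Proof.
move=> K0 e0 /andP[a0 am] nK dev.
have [->|a_neq0] := eqVneq a 0.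
  by rewrite mulr0 subr_ge0 hyp_supporting.
have a_gt0 : 0 < a by rewrite lt_def a_neq0.
have m_gt0 : 0 < m by exact: lt_le_trans am.
set x := b / a in dev; set y := n / m in dev.
have -> : b = a * x by rewrite mulrC divfK.
have -> : n = m * y by rewrite mulrC divfK// gt_eqF.
rewrite !hyp_scale ?(ltW m_gt0)//.
have yK : `|y| <= K by rewrite normrM normfV (gtr0_norm m_gt0) ler_pdivrMr.
have h0 : hyp 1 y != 0.
  have := sqr_hyp 1 y; have := sqr_ge0 y; rewrite expr1n => y2 h2.
  by apply/eqP => h; rewrite h expr0n/= in h2; lra.
have -> : a * hyp 1 x - (a * m + a * x * (m * y)) / (m * hyp 1 y)
   = (hyp 1 x - (1 + x * y) / hyp 1 y) * a.
  by field; rewrite h0 gt_eqF.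
by apply: ler_wpM2r => //; exact: slope_gap.
Qed.

End Hypotenuse.

(** * Additive functions on partitions and their refinements *)

Section Regularity.
Context {d : Order.disp_t} {S : ctbDistrLatticeType d} {R : realType}.
Implicit Types (mu nu F : S -> R) (P Q : fpartition S) (s t : S).

Lemma additive_split nu s t : additive_fun nu ->
  nu t = nu (t `&` s)%O + nu (t `\` s)%O.
Proof.
case=> nu0 nuU; have := nuU (t `&` s)%O (t `\` s)%O.
by rewrite joinIB meetIB nu0 subr0.
Qed.

Lemma additive_sum nu (r : seq S) (p : pred S) : additive_fun nu -> uniq r ->
  {in r &, forall s t, s != t -> (s `&` t)%O = \bot%O} ->
  nu (\join_(s <- r | p s) s)%O = \sum_(s <- r | p s) nu s.
Proof.
move=> [nu0 nuU]; elim: r => [|s r IH] /=; first by rewrite !big_nil.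
move=> /andP[s_r r_uniq] disj.
have {}IH : nu (\join_(t <- r | p t) t)%O = \sum_(t <- r | p t) nu t.
  by apply: IH => // t u tr ur; apply: disj; rewrite inE ?tr ?ur orbT.
rewrite !big_cons; case: (p s) => //; rewrite nuU IH.
suff -> : (s `&` \join_(t <- r | p t) t)%O = \bot%O by rewrite nu0 subr0.
apply/eqP; rewrite meetC disj_leC; apply/joinsP_seq => t tr _.
rewrite -disj_leC; apply/eqP/disj; rewrite ?inE ?tr ?eqxx ?orbT//.
by apply: contraNneq s_r => <-.
Qed.

Lemma fpartition_disjoint P :
  {in pset P &, forall s t, s != t -> (s `&` t)%O = \bot%O}.
Proof.
move=> s t sP tP st; have := psetP P.
move=> /forallP/(_ [` sP]%fset)/forallP/(_ [` tP]%fset)/implyP H.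
by apply/eqP/H; rewrite -val_eqE.
Qed.

Lemma additive_fpartition nu P (p : pred S) : additive_fun nu ->
  nu (\join_(s <- P | p s) s)%O = \sum_(s <- P | p s) nu s.
Proof.
by move=> nu_add; apply: additive_sum => //; [exact: fset_uniq |
  exact: fpartition_disjoint].
Qed.

Lemma refined_by_refl P : refined_by P P.
Proof. by split=> // s sP; exists s. Qed.

Lemma refined_by_trans P2 P1 P3 :
  refined_by P1 P2 -> refined_by P2 P3 -> refined_by P1 P3.
Proof.
move=> [j12 sub12] [j23 sub23]; split=> [|s]; first by rewrite j12.
move=> /sub23[t /sub12[u uP tu] st].
by exists u => //; exact: le_trans tu.
Qed.

Section Ancestor.
Variables (P Q : fpartition S).
Hypothesis PQ : refined_by P Q.

Lemma ancestorP s : s \in pset Q ->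
  ancestor P s \in pset P /\ (s <= ancestor P s)%O.
Proof.
move=> /PQ.2[t tP st]; rewrite /ancestor.
case: pickP => [u su|/(_ [` tP]%fset)] /=; first by split; first exact: valP.
by rewrite st.
Qed.

(** Since [ancestor P] is a function, each cell is counted once, even [\bot], which lies below every
    cell of [P]. *)
Lemma sum_ancestor F :
  \sum_(s <- Q) F s = \sum_(t <- P) \sum_(s <- Q | ancestor P s == t) F s.
Proof.
rewrite (exchange_big_dep xpredT)//= big_seq [RHS]big_seq.
apply: eq_bigr => s /ancestorP[aP _].
rewrite -big_filter (eq_filter (a2 := pred1 (ancestor P s))).
  by rewrite filter_pred1_uniq ?fset_uniq// big_seq1.
by move=> t /=; rewrite eq_sym.
Qed.

Lemma join_ancestor t : t \in pset P ->
  (\join_(s <- Q | ancestor P s == t) s)%O = t.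
Proof.
move=> tP; apply/le_anti/andP; split.
  by apply/joinsP_seq => s /ancestorP[_ +] /eqP => /[swap] ->.
(* Distributing [t] over the join of [Q] leaves only the cells with ancestor [t]: the others lie in
   cells of [P] disjoint from [t]. *)
have tQ : (t <= \join_(s <- Q) s)%O by rewrite -PQ.1 joins_sup_seq.
rewrite -[leLHS](meet_idPl tQ) (bigID (fun s => ancestor P s == t))/=.
rewrite meetUr leUx leIr/=.
suff /eqP -> : (t `&` \join_(s <- Q | ancestor P s != t) s)%O == \bot%O
  by exact: le0x.
rewrite meetC disj_leC; apply/joinsP_seq => s sQ st.
have [aP sa] := ancestorP sQ.
rewrite -disj_leC -lex0 -(fpartition_disjoint aP tP st).
by rewrite leI2.
Qed.

Lemma additive_ancestor nu t : additive_fun nu -> t \in pset P ->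
  \sum_(s <- Q | ancestor P s == t) nu s = nu t.
Proof. by move=> nu_add tP; rewrite -additive_fpartition// join_ancestor. Qed.

End Ancestor.

Lemma additive_ge0_le mu s t : additive_fun mu -> (forall u, 0 <= mu u) ->
  (s <= t)%O -> mu s <= mu t.
Proof.
move=> mu_add mu0 st; rewrite (additive_split s t mu_add) (meet_idPr st).
by rewrite lerDl.
Qed.

(** * Boundedness and bounded variation *)

Lemma is_partition1 s : is_partition [fset s]%fset.
Proof.
apply/forallP => x; apply/forallP => y; apply/implyP => /eqP[].
by apply/val_inj; have /fset1P -> := valP x; have /fset1P -> := valP y.
Qed.

Lemma absolutely_continuous_bounded mu nu :
  additive_fun mu -> (forall s, 0 <= mu s) -> additive_fun nu ->
  absolutely_continuous mu nu -> exists M : R, forall s, `|nu s| <= M.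
Proof.
move=> mu_add mu0 nu_add /(_ 1%N isT)[D D_gt0 acD].
have Dr0 : 0 < D%:R :> R by rewrite ltr0n.
have small s : mu s < D%:R^-1 -> `|nu s| < 1.
  have := acD (FPartition (is_partition1 s)).
  by rewrite /fset_sum !big_seq_fset1 invr1.
(* An element below t on which |nu| exceeds |nu t| + 1 splits t into two parts
   on both of which |nu| is at least 1, so that both have measure at least
   1 / D. *)
have bounded n : forall t, mu t * D%:R < n%:R ->
    exists M, forall s, (s <= t)%O -> `|nu s| <= M.
  elim: n => [|n IH] t tn.
    by have := mulr_ge0 (mu0 t) (ltW Dr0); lra.
  have [|/existsNP[s /not_implyP[st /negP]]] :=
      pselect (forall s, (s <= t)%O -> `|nu s| <= `|nu t| + 1).
    by exists (`|nu t| + 1).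
  rewrite -ltNge => s_large.
  have mut := additive_split s t mu_add; have nut := additive_split s t nu_add.
  rewrite !(meet_idPr st) in mut nut.
  have heavy u : 1 <= `|nu u| -> 1 <= mu u * D%:R.
    move=> u1; rewrite leNgt; apply/negP => uD.
    have : `|nu u| < 1 by apply: small; rewrite -div1r ltr_pdivlMr.
    lra.
  have s1 : 1 <= mu s * D%:R by apply: heavy; have := normr_ge0 (nu t); lra.
  have d1 : 1 <= mu (t `\` s)%O * D%:R.
    apply: heavy; have := ler_normB (nu t) (nu (t `\` s)%O).
    by rewrite {1}nut addrK; lra.
  (* Each part takes at least 1 from [mu t * D%:R], so less than [n] remains for the other. *)
  rewrite mut mulrDl -natr1 in tn.
  have [M1 bM1] := IH s ltac:(lra).
  have [M2 bM2] := IH (t `\` s)%O ltac:(lra).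
  exists (M1 + M2) => r rt; rewrite (additive_split s r nu_add).
  apply: le_trans (ler_normD _ _) _; apply: lerD.
    by apply: bM1; exact: leIr.
  by apply: bM2; exact: leBl.
have /bounded[M bM] : mu \top%O * D%:R < (Num.truncn (mu \top%O * D%:R)).+1%:R.
  by rewrite truncnS_gt.
by exists M => s; apply: bM; exact: lex1.
Qed.

(** Merging the cells with [nu s >= 0] into [x] and the rest into [y] turns the variation into
    [nu x - nu y]. *)
Lemma variation_le nu P M : additive_fun nu -> (forall s, `|nu s| <= M) ->
  fset_sum (absval nu) P <= 2 * M.
Proof.
move=> nu_add nuM; rewrite /fset_sum /absval (bigID (fun s => 0 <= nu s))/=.
rewrite (eq_bigr nu); last by move=> s; exact: ger0_norm.
rewrite [X in _ + X](eq_bigr (fun s => - nu s)); last first.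
  by move=> s; rewrite -ltNge; exact: ltr0_norm.
rewrite sumrN -!additive_fpartition//.
set x := (\join_(s <- _ | _) s)%O; set y := (\join_(s <- _ | _) s)%O.
have := ler_norm (nu x); have := ler_norm (- nu y); rewrite normrN.
have := nuM x; have := nuM y; lra.
Qed.

(** * Energy and its gain under refinement *)

Section Energy.
Context (mu nu : S -> R).
Hypotheses (mu_add : additive_fun mu) (mu_ge0 : forall s, 0 <= mu s).
Hypothesis nu_add : additive_fun nu.

Definition energy P : R := fset_sum (fun s => hyp (mu s) (nu s)) P.

Lemma energy_le P : energy P <= mu \top%O + fset_sum (absval nu) P.
Proof.
apply: (@le_trans _ _ (fset_sum mu P + fset_sum (absval nu) P)).
  rewrite /energy /fset_sum -big_split/=; apply: ler_sum => s _.
  by rewrite -{2}(ger0_norm (mu_ge0 s)) hyp_le_norm.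
rewrite lerD2r /fset_sum -additive_fpartition//.
by rewrite additive_ge0_le// lex1.
Qed.

(** The bound holds separately over each cell [t] of [P]. If the density of [t] is at most [K] in
    absolute value, [hyp_gap] applies to its subcells; otherwise the variation term pays for all of
    [mu t]. *)
Lemma deviation_le_energy_gain P Q (E : nat) (K : R) : refined_by P Q ->
  (0 < E)%N -> 0 < K ->
  convexity_gap K E%:R^-1 * fset_sum mu (deviation_set mu nu E P Q) <=
    energy Q - energy P
    + convexity_gap K E%:R^-1 * (fset_sum (absval nu) P / K).
Proof.
move=> PQ E0 K0; set c := convexity_gap _ _.
have e0 : 0 < E%:R^-1 :> R by rewrite invr_gt0 ltr0n.
have c0 : 0 < c by rewrite convexity_gap_gt0// ltW.
pose dev s := E%:R^-1 <= `|density mu nu s - density mu nu (ancestor P s)|.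
rewrite /energy /fset_sum /deviation_set big_fset/= (big_mkcond dev)/=.
rewrite !(sum_ancestor PQ) mulr_suml !mulr_sumr -sumrB -big_split/=.
rewrite big_seq [leRHS]big_seq; apply: ler_sum => t tP.
set H := fun s => hyp (mu s) (nu s).
(* The functional supporting the norm at [(mu t, nu t)]. By linearity its values on the subcells of
   [t] add up to [H t], so the gain is a sum of nonnegative terms [H s - L s]. *)
pose L s := (mu s * mu t + nu s * nu t) / H t.
have HL s : L s <= H s by exact: hyp_supporting.
have sumL : \sum_(s <- Q | ancestor P s == t) L s = H t.
  rewrite -mulr_suml big_split/= -!mulr_suml !additive_ancestor//.
  rewrite -!expr2 -sqr_hyp -/(H t) expr2.
  by have [->|h0] := eqVneq (H t) 0; rewrite ?mul0r ?mulfK.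
have gain : \sum_(s <- Q | ancestor P s == t) H s - H t =
    \sum_(s <- Q | ancestor P s == t) (H s - L s) by rewrite sumrB sumL.
rewrite gain /absval.
have [nuK|nuK] := leP `|nu t| (K * mu t).
  apply: ler_wpDr; first by apply: mulr_ge0 (ltW c0) _;
    apply: divr_ge0 (normr_ge0 _) (ltW K0).
  rewrite mulr_sumr big_seq_cond [leRHS]big_seq_cond.
  apply: ler_sum => s /andP[sQ /eqP st].
  case: ifPn => [|_]; last by rewrite mulr0 subr_ge0.
  rewrite /dev st => ?; apply: hyp_gap => //; first exact: ltW.
  rewrite mu_ge0/= additive_ge0_le// -st; exact: (ancestorP PQ sQ).2.
apply: ler_wpDl; first by apply: sumr_ge0 => s _; rewrite subr_ge0.
rewrite ler_pM2l// ler_pdivlMr//; apply: le_trans (ltW nuK).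
rewrite mulrC ler_pM2l// -(additive_ancestor PQ mu_add tP).
by apply: ler_sum => s _; case: ifP.
Qed.

End Energy.
End Regularity.

Theorem theorem5p4 (R : realType) (d : Order.disp_t)
    (S : ctbDistrLatticeType d) (mu nu : S -> R)
    (mu_add : additive_fun mu)
    (mu_01 : forall s : S, 0 <= mu s <= 1)
    (mu_top : mu \top%O = 1)
    (nu_add : additive_fun nu)
    (nu_ac : absolutely_continuous mu nu)
    (A : fpartition S) (E D : nat) (E_gt0 : (0 < E)%N) (D_gt0 : (0 < D)%N)
    (BB : fpartition S -> fpartition S)
    (BB_refines : forall P : fpartition S, refined_by P (BB P)) :
  exists2 Bs : fpartition S, refined_by A Bs &
    forall B : fpartition S, refined_by Bs B -> refined_by B (BB Bs) ->
      fset_sum mu (deviation_set mu nu E Bs B) < D%:R^-1.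
Proof.
have mu_ge0 s : 0 <= mu s by case/andP: (mu_01 s).
have [M nuM] := absolutely_continuous_bounded mu_add mu_ge0 nu_add nu_ac.
have M0 : 0 <= M := le_trans (normr_ge0 _) (nuM \top%O).
have D0 : 0 < D%:R :> R by rewrite ltr0n.
have var P := variation_le P nu_add nuM.
(* With variation at most [2 * M], this makes the steep cells cost at most [1 / (2 * D)]; [M + 1]
   keeps [K] positive when [M = 0]. *)
pose K : R := 4 * (M + 1) * D%:R.
have K0 : 0 < K by rewrite !mulr_gt0//; lra.
pose c := convexity_gap K E%:R^-1.
have c0 : 0 < c by rewrite convexity_gap_gt0 ?ltW// invr_gt0 ltr0n.
pose energies : set R :=
  [set x | exists2 P, refined_by A P & x = energy mu nu P]%classic.
have energies_sup : has_sup energies.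
  split; first by exists (energy mu nu A); exists A => //;
    exact: refined_by_refl.
  exists (1 + 2 * M) => _ [P _ ->].
  by apply: le_trans (energy_le nu mu_add mu_ge0 P) _; rewrite mu_top lerD2l.
(* Half of the budget [c / D]; the other half goes to the steep cells. *)
have eps0 : 0 < c / (2 * D%:R) by rewrite divr_gt0// mulr_gt0.
have [_ [Bs ABs ->] Bs_large] := sup_adherent eps0 energies_sup.
exists Bs => // B BsB _.
have B_le : energy mu nu B <= sup energies.
  by apply: sup_upper_bound => //; exists B => //; exact: refined_by_trans BsB.
have := deviation_le_energy_gain mu_add mu_ge0 nu_add BsB E_gt0 K0.
rewrite -/c => dev_le.
have varK : fset_sum (absval nu) Bs / K <= (2 * D%:R)^-1.
  rewrite ler_pdivrMr//; apply: le_trans (var Bs) _.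
  have -> : (2 * D%:R)^-1 * K = 2 * (M + 1) by rewrite /K; field; lra.
  lra.
rewrite -(ltr_pM2l c0); apply: le_lt_trans dev_le _.
(* The strict inequality comes from [Bs_large]. *)
have -> : c * D%:R^-1 = c / (2 * D%:R) + c / (2 * D%:R) by field; lra.
have := ler_wpM2l (ltW c0) varK; lra.
Qed.
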